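(* Let $(X,\rho)$ be a complete, separable, unbounded hyperbolic metric space and let $\omega:[0,+\infty)\to[0,+\infty)$ be a continuous, concave, nonzero and nondecreasing function with $\omega(0)=0$. If $\mathcal{C}_\omega(X)$ is endowed with the topology of pointwise convergence (metrised by the complete metric $d_\Theta(f,g)=\sum_{n=1}^\infty 2^{-n}\min\{1,\rho(f(\theta_n),g(\theta_n))\}$ for a dense sequence $\{\theta_n\}$ in $X$), then there is a meagre set $\mathcal{M}\subset\mathcal{C}_\omega(X)$ such that $\omega_f=\omega$ for every $f\in\mathcal{C}_\omega(X)\setminus\mathcal{M}$.
   Context: A metric space $(X,\rho)$ has a coherent system of geodesics $\Gamma$ if $\Gamma$ is a family of isometries $\gamma:[0,\rho(x,y)]\to X$ with $\gamma(0)=x$, $\gamma(\rho(x,y))=y$ such that: (1) for all $x,y$ there is a unique $\gamma\in\Gamma$ from $x$ to $y$; (2) if $\gamma\in\Gamma$ goes from $x$ to $y$, then $t\mapsto\gamma(\rho(x,y)-t)$ is the element of $\Gamma$ from $y$ to $x$; (3) if $\gamma\in\Gamma$ goes from $x$ to $y$ and $0\le t_1\le t_2\le\rho(x,y)$, then $t\mapsto\gamma(t+t_1)$ on $[0,t_2-t_1]$ is the element of $\Gamma$ from $\gamma(t_1)$ to $\gamma(t_2)$. Write $(1-t)x\oplus ty=\gamma(t\rho(x,y))$ with $\gamma\in\Gamma$ from $x$ to $y$. $X$ is hyperbolic if $\rho((1-t)x\oplus ty,(1-t)x\oplus tz)\le t\rho(y,z)$ for all $x,y,z\in X$, $t\in[0,1]$.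 The modulus of continuity of $f:X\to X$ is $\omega_f(s)=\sup\{\rho(f(x),f(y)):\rho(x,y)\le s\}$, and $\mathcal{C}_\omega(X)$ is the set of maps $f:X\to X$ with $\omega_f\le\omega$. *)

(* Defs.v *)
From Stdlib Require Import Reals Lra List.
From Coquelicot Require Import Coquelicot.
Open Scope R_scope.

Section Defs.
Variable X : Type.
Variable rho : X -> X -> R.

Definition is_metric : Prop :=
  (forall x y, 0 <= rho x y) /\
  (forall x y, rho x y = 0 <-> x = y) /\
  (forall x y, rho x y = rho y x) /\
  (forall x y z, rho x z <= rho x y + rho y z).

Definition complete_space : Prop :=
  forall u : nat -> X,
    (forall eps, 0 < eps -> exists N, forall m n, (N <= m)%nat -> (N <= n)%nat ->
        rho (u m) (u n) < eps) ->
    exists l, forall eps, 0 < eps -> exists N, forall n, (N <= n)%nat -> rho (u n) l < eps.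

Definition separable_space : Prop :=
  exists theta : nat -> X, forall x eps, 0 < eps -> exists n, rho x (theta n) < eps.

Definition unbounded_space : Prop :=
  forall M : R, exists x y, M < rho x y.

(** A coherent system of geodesics Gamma: since Gamma contains exactly one
    geodesic from x to y (condition (1)), it is represented by the selection
    [geo x y : R -> X], the element of Gamma from x to y, of which only the
    values on [0, rho x y] are relevant. *)
Definition coherent_geodesics (geo : X -> X -> R -> X) : Prop :=
  (forall x y s t, 0 <= s <= rho x y -> 0 <= t <= rho x y ->
      rho (geo x y s) (geo x y t) = Rabs (s - t)) /\
  (forall x y, geo x y 0 = x) /\
  (forall x y, geo x y (rho x y) = y) /\
  (forall x y t, 0 <= t <= rho x y -> geo y x t = geo x y (rho x y - t)) /\
  (forall x y t1 t2 t, 0 <= t1 -> t1 <= t2 -> t2 <= rho x y -> 0 <= t <= t2 - t1 ->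
      geo (geo x y t1) (geo x y t2) t = geo x y (t + t1)).

Definition convex_comb (geo : X -> X -> R -> X) (x y : X) (t : R) : X :=
  geo x y (t * rho x y).

Definition hyperbolic (geo : X -> X -> R -> X) : Prop :=
  forall x y z t, 0 <= t <= 1 ->
    rho (convex_comb geo x y t) (convex_comb geo x z t) <= t * rho y z.

Definition modulus (f : X -> X) (s : R) : Rbar :=
  Lub_Rbar (fun r => exists x y, rho x y <= s /\ r = rho (f x) (f y)).

Definition C_omega (omega : R -> R) (f : X -> X) : Prop :=
  forall s, 0 <= s -> Rbar_le (modulus f s) (Finite (omega s)).

Definition pw_nbhd (S : (X -> X) -> Prop) (g : X -> X) (l : list X) (eps : R)
  (f : X -> X) : Prop :=
  S f /\ forall x, In x l -> rho (f x) (g x) < eps.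

Definition pw_open (S U : (X -> X) -> Prop) : Prop :=
  (forall f, U f -> S f) /\
  forall g, U g -> exists (l : list X) (eps : R), 0 < eps /\
     forall f, pw_nbhd S g l eps f -> U f.

Definition pw_closure (S A : (X -> X) -> Prop) (g : X -> X) : Prop :=
  S g /\ forall (l : list X) (eps : R), 0 < eps ->
     exists f, pw_nbhd S g l eps f /\ A f.

Definition pw_nowhere_dense (S A : (X -> X) -> Prop) : Prop :=
  forall U, pw_open S U -> (forall f, U f -> pw_closure S A f) -> forall f, ~ U f.

Definition pw_meagre (S M : (X -> X) -> Prop) : Prop :=
  exists A : nat -> (X -> X) -> Prop,
    (forall n, pw_nowhere_dense S (A n)) /\
    (forall f, M f -> exists n, A n f).

End Defs.

Definition admissible_omega (omega : R -> R) : Prop :=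
  (forall s, 0 <= s -> 0 <= omega s) /\
  (forall s, 0 <= s -> forall eps, 0 < eps -> exists delta, 0 < delta /\
      forall t, 0 <= t -> Rabs (t - s) < delta -> Rabs (omega t - omega s) < eps) /\
  (forall s t l, 0 <= s -> 0 <= t -> 0 <= l <= 1 ->
      l * omega s + (1 - l) * omega t <= omega (l * s + (1 - l) * t)) /\
  (exists s, 0 <= s /\ omega s <> 0) /\
  (forall s t, 0 <= s <= t -> omega s <= omega t) /\
  omega 0 = 0.

(* Main.v *)
(** For fixed [s] and [eta > 0] the set of [f] in [C_omega] with
    [rho (f x) (f y) <= omega s - eta] whenever [rho x y <= s] is closed, and countably
    many such sets (rational [s]) cover all [f] whose modulus differs from [omega].
    Each has empty interior: given [g], shrink [g] towards [q = g p] by a factor that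
    decays logarithmically with the distance to [p], giving [f1] in [C_omega] close to [g]
    on a prescribed finite set and equal to [q] off a ball of radius [r1]. Very far from
    [p], glue in a bump realising [c * omega s] with [c < 1] close to 1. When [omega] is
    bounded the bump must stay within [sup omega] of the range of [f1]: it therefore runs
    along a geodesic from a point [u] of that range to a point [w] at distance almost
    [omega T] from [u] and at most [omega T] from the whole range, [T = max (2 * r1) s],
    and then returns slowly to [q]. *)
Require Import Defs.
From Stdlib Require Import Reals Lra Lia List Classical Cantor.
From Coquelicot Require Import Coquelicot.
Open Scope R_scope.

(** * Consequences of concavity for [omega] *)

(** Concavity on the segment from 0 to [a] together with [omega 0 = 0]: the quotient [omega r / r]
    does not increase. The product form admits zero arguments. *)
Lemma admissible_omega_ratio omega a d :
  admissible_omega omega -> 0 <= d <= a -> d * omega a <= a * omega d.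
Proof.
intros (Hpos & _ & Hconc & _ & _ & H0) [Hd Hda].
destruct (Req_dec a 0) as [->|Ha]; [replace d with 0 by lra; lra|].
assert (Ha' : 0 < a) by lra.
assert (E : d / a * a = d) by (field; lra).
assert (Hl : 0 <= d / a <= 1).
{ split; [apply Rdiv_le_0_compat; lra|].
  apply Rmult_le_reg_r with a; lra. }
pose proof (Hconc a 0 (d / a) ltac:(lra) ltac:(lra) Hl) as C.
rewrite H0, E, !Rmult_0_r, !Rplus_0_r in C.
apply Rmult_le_compat_l with (r := a) in C; [|lra].
replace (a * (d / a * omega a)) with (d / a * a * omega a) in C by ring.
rewrite E in C; exact C.
Qed.

Lemma admissible_omega_subadditive omega a b :
  admissible_omega omega -> 0 <= a -> 0 <= b -> omega (a + b) <= omega a + omega b.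
Proof.
intros Ho Ha Hb.
destruct (Req_dec (a + b) 0) as [E|E].
{ replace a with 0 by lra; replace b with 0 by lra.
  destruct Ho as (_ & _ & _ & _ & _ & H0); rewrite Rplus_0_l, H0; lra. }
pose proof (admissible_omega_ratio omega (a + b) a Ho ltac:(lra)).
pose proof (admissible_omega_ratio omega (a + b) b Ho ltac:(lra)).
apply Rmult_le_reg_l with (a + b); nra.
Qed.

Lemma admissible_omega_pos omega s : admissible_omega omega -> 0 < s -> 0 < omega s.
Proof.
intros Ho Hs.
pose proof Ho as (Hpos & _ & _ & (s0 & Hs0 & Hne) & Hmon & H0).
pose proof (Hpos s0 Hs0).
destruct (Rle_or_lt s0 s) as [Hle|Hlt].
- pose proof (Hmon s0 s ltac:(lra)); lra.
- pose proof (admissible_omega_ratio omega s0 s Ho ltac:(lra)).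
  assert (0 < omega s0) by lra.
  apply Rmult_lt_reg_l with s0; nra.
Qed.

(** * The logarithmic cut-off *)

Lemma ln_sub_le a b : 0 < a -> 0 < b -> a * (ln b - ln a) <= b - a.
Proof.
intros Ha Hb.
assert (Hq : 0 < b / a) by (apply Rdiv_lt_0_compat; lra).
rewrite <- ln_div by lra.
assert (H : ln (b / a) <= b / a - 1).
{ rewrite <- (ln_exp (b / a - 1)); apply ln_le; [exact Hq|].
  pose proof (exp_ineq1_le (b / a - 1)); lra. }
apply Rmult_le_compat_l with (r := a) in H; [|lra].
replace (b - a) with (a * (b / a - 1)) by (field; lra); exact H.
Qed.

(* A plateau followed by logarithmic decay: the slope at [r] is at most [e / r],
   which is what concavity of the modulus can absorb on an unbounded target. *)
Lemma log_cutoff e r0 : 0 < e < 1 -> 0 < r0 ->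
  exists (lam : R -> R) (r1 : R), r0 <= r1 /\
    (forall r, 0 <= lam r <= 1 - e) /\
    (forall r, r <= r0 -> lam r = 1 - e) /\
    (forall r, r1 <= r -> lam r = 0) /\
    (forall a b, 0 <= a <= b -> lam b <= lam a /\ (lam a - lam b) * a <= e * (b - a)).
Proof.
intros He Hr0.
(* At [r0 * exp (/ e)] the logarithm has grown by [/ e], so the second argument of [Rmax] is already
   [- e]. *)
exists (fun r => Rmax 0 (1 - e - e * (ln (Rmax r0 r) - ln r0))), (r0 * exp (/ e)).
assert (Hi : 0 < / e) by (apply Rinv_0_lt_compat; lra).
assert (Hexp : 1 <= exp (/ e)) by (pose proof (exp_ineq1_le (/ e)); lra).
assert (Hln : forall a b, a <= b -> ln (Rmax r0 a) <= ln (Rmax r0 b)).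
{ intros a b Hab; apply ln_le.
  - pose proof (Rmax_l r0 a); lra.
  - apply Rle_max_compat_l; exact Hab. }
assert (Hln0 : forall a, ln r0 <= ln (Rmax r0 a))
  by (intros a; apply ln_le; [lra|apply Rmax_l]).
repeat split.
- nra.
- apply Rmax_l.
- apply Rmax_lub; [lra|]. pose proof (Hln0 r). nra.
- intros r Hr; rewrite (Rmax_left r0 r) by lra.
  rewrite Rmax_right; lra.
- intros r Hr.
  assert (Hm : r0 * exp (/ e) <= Rmax r0 r) by (pose proof (Rmax_r r0 r); lra).
  apply ln_le in Hm; [|apply Rmult_lt_0_compat; lra].
  rewrite ln_mult, ln_exp in Hm by lra.
  apply Rmax_left.
  apply Rmult_le_compat_l with (r := e) in Hm; [|lra].
  rewrite Rmult_plus_distr_l, Rinv_r in Hm by lra; lra.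
- apply Rle_max_compat_l. pose proof (Hln a b ltac:(lra)); nra.
- set (A := Rmax r0 a); set (B := Rmax r0 b).
  assert (HA : r0 <= A /\ a <= A) by (split; [apply Rmax_l|apply Rmax_r]).
  assert (HB : r0 <= B /\ b <= B) by (split; [apply Rmax_l|apply Rmax_r]).
  assert (HAB : B - A <= b - a) by (unfold A, B, Rmax; repeat destruct Rle_dec; lra).
  pose proof (Hln a b ltac:(lra)) as HL; fold A B in HL.
  pose proof (ln_sub_le A B ltac:(lra) ltac:(lra)) as HS.
  set (v := Rmax 0 _) in |- * at 1; set (v' := Rmax 0 _).
  assert (Hv : 0 <= v - v' <= e * (ln B - ln A)).
  { unfold v, v', Rmax; repeat destruct Rle_dec; nra. }
  apply Rle_trans with ((v - v') * A); [nra|].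
  apply Rle_trans with (e * (A * (ln B - ln A))); [nra|].
  apply Rmult_le_compat_l; lra.
Qed.

(** * Geodesics and convexity in hyperbolic spaces *)

Section Hyperbolic.

Variables (X : Type) (rho : X -> X -> R) (geo : X -> X -> R -> X).
Hypotheses (Hm : is_metric X rho) (Hg : coherent_geodesics X rho geo)
  (Hh : hyperbolic X rho geo).

Local Notation cc := (convex_comb X rho geo).

Lemma rho_pos x y : 0 <= rho x y. Proof. apply Hm. Qed.
Lemma rho_sym x y : rho x y = rho y x. Proof. apply Hm. Qed.
Lemma rho_tri x y z : rho x z <= rho x y + rho y z. Proof. apply Hm. Qed.
Lemma rho_refl x : rho x x = 0. Proof. destruct Hm as (_ & H & _); apply H; reflexivity. Qed.
Lemma rho_eq x y : rho x y = 0 -> x = y. Proof. destruct Hm as (_ & H & _); apply H. Qed.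

Lemma convex_comb_dist x y s t : 0 <= s <= 1 -> 0 <= t <= 1 ->
  rho (cc x y s) (cc x y t) = Rabs (s - t) * rho x y.
Proof.
intros Hs Ht; pose proof (rho_pos x y); unfold convex_comb.
destruct Hg as (H1 & _); rewrite H1 by nra.
rewrite <- Rmult_minus_distr_r, Rabs_mult, (Rabs_pos_eq (rho x y)) by lra; reflexivity.
Qed.

Lemma convex_comb_0 x y : cc x y 0 = x.
Proof. unfold convex_comb; rewrite Rmult_0_l; apply Hg. Qed.

Lemma convex_comb_dist_l x y t : 0 <= t <= 1 -> rho x (cc x y t) = t * rho x y.
Proof.
intros Ht; rewrite <- (convex_comb_0 x y) at 1.
rewrite convex_comb_dist by lra.
rewrite Rminus_0_l, Rabs_Ropp, Rabs_pos_eq by lra; reflexivity.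
Qed.

Lemma convex_comb_dist_r x y t : 0 <= t <= 1 -> rho (cc x y t) y = (1 - t) * rho x y.
Proof.
intros Ht.
assert (E : cc x y 1 = y) by (unfold convex_comb; rewrite Rmult_1_l; apply Hg).
rewrite <- E at 2; rewrite convex_comb_dist by lra.
rewrite Rabs_minus_sym, Rabs_pos_eq by lra; reflexivity.
Qed.

(** Balls are convex: pass through [cc x a t], whose distance to [cc x y t] is controlled by
    hyperbolicity. *)
Lemma convex_comb_ball a x y t L : 0 <= t <= 1 ->
  rho a x <= L -> rho a y <= L -> rho a (cc x y t) <= L.
Proof.
intros Ht Hx Hy.
pose proof (rho_tri a (cc x a t) (cc x y t)).
pose proof (convex_comb_dist_r x a t Ht).
pose proof (Hh x a y t Ht).
rewrite (rho_sym a (cc x a t)) in *; rewrite (rho_sym x a) in *.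
nra.
Qed.

(** Slide along the geodesic towards [x] from parameter [s] down to [t], then cross to [cc q y t] by
    hyperbolicity. *)
Lemma convex_comb_interp q x y s t : 0 <= t <= s -> s <= 1 ->
  rho (cc q x s) (cc q y t) <= (s - t) * rho q x + t * rho x y.
Proof.
intros Ht Hs.
pose proof (rho_tri (cc q x s) (cc q x t) (cc q y t)).
pose proof (convex_comb_dist q x s t ltac:(lra) ltac:(lra)) as E.
rewrite Rabs_pos_eq in E by lra.
pose proof (Hh q x y t ltac:(lra)); lra.
Qed.

Lemma unbounded_far (Hu : unbounded_space X rho) x r : exists y, r < rho x y.
Proof.
destruct (Hu (2 * r)) as (a & b & Hab).
pose proof (rho_tri a x b); rewrite (rho_sym a x) in *.
destruct (Rlt_or_le r (rho x a)); [exists a|exists b]; lra.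
Qed.

(* Move a point away from [P] along a long geodesic, and stop just before it leaves
   the intersection of the balls of radius [L] centred in [P]. *)
Lemma extremal_point (Hu : unbounded_space X rho) (P : X -> Prop) q L delta :
  P q -> (forall a b, P a -> P b -> rho a b <= L) -> 0 < delta ->
  exists u w, P u /\ (forall a, P a -> rho a w <= L) /\ L - delta < rho u w.
Proof.
intros Pq HP Hd.
assert (HL : 0 <= L) by (rewrite <- (rho_refl q); auto).
destruct (unbounded_far Hu q (L + delta)) as [v Hv].
set (g := geo q v).
assert (Hgq : forall t, 0 <= t <= rho q v -> rho q (g t) = t).
{ intros t Ht; destruct Hg as (H1 & H2 & _).
  unfold g; rewrite <- (H2 q v) at 1; rewrite H1 by lra.
  rewrite Rminus_0_l, Rabs_Ropp, Rabs_pos_eq; lra. }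
set (E := fun t => 0 <= t <= rho q v /\ forall a, P a -> rho a (g t) <= L).
assert (HEL : forall t, E t -> t <= L).
{ intros t [Ht Ha]; rewrite <- (Hgq t Ht); auto. }
destruct (completeness E) as [m [Hub Hlub]].
{ exists L; exact HEL. }
{ exists 0; split; [lra|]; intros a Pa.
  unfold g; destruct Hg as (_ & -> & _); auto. }
destruct (classic (exists t, E t /\ m - delta < t)) as [(t & Et & Hmt)|Hno].
2:{ exfalso; assert (m <= m - delta); [|lra].
    apply Hlub; intros t Et; apply Rnot_lt_le; intros Hlt; apply Hno; eauto. }
pose proof (HEL t Et) as HtL; destruct Et as [Ht Ha].
(* [t + delta] lies past the supremum [m] but still on the geodesic, since [t <= L] and
   [L + delta < rho q v]. Hence some ball is left within distance [delta] after [g t]. *)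
assert (HnE : ~ E (t + delta)) by (intros HE; apply Hub in HE; lra).
destruct (classic (exists a, P a /\ L < rho a (g (t + delta)))) as [(a & Pa & Hla)|Hno].
- exists a, (g t); repeat split; auto.
  pose proof (rho_tri a (g t) (g (t + delta))).
  assert (rho (g t) (g (t + delta)) = delta); [|lra].
  unfold g; destruct Hg as (H1 & _); rewrite H1 by lra.
  rewrite Rabs_minus_sym, Rabs_pos_eq; lra.
- exfalso; apply HnE; split; [lra|]; intros a Pa.
  apply Rnot_lt_le; intros Hlt; apply Hno; eauto.
Qed.

(** * Maps with modulus bounded by [omega] *)

Variable omega : R -> R.
Hypothesis Ho : admissible_omega omega.

Lemma omega_mono s t : 0 <= s <= t -> omega s <= omega t.
Proof. apply Ho. Qed.

Lemma omega_nonneg s : 0 <= s -> 0 <= omega s.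
Proof. apply Ho. Qed.

Lemma C_omega_iff f :
  C_omega X rho omega f <-> forall x y, rho (f x) (f y) <= omega (rho x y).
Proof.
split.
- intros Hf x y.
  pose proof (Hf (rho x y) (rho_pos x y)) as H; unfold modulus in H.
  destruct (Lub_Rbar_correct
    (fun r => exists a b, rho a b <= rho x y /\ r = rho (f a) (f b))) as [Hub _].
  assert (Hb : Rbar_le (rho (f x) (f y)) (omega (rho x y))).
  { eapply Rbar_le_trans; [|exact H]; apply Hub.
    exists x, y; split; [lra|reflexivity]. }
  exact Hb.
- intros Hf s Hs; unfold modulus.
  apply (proj2 (Lub_Rbar_correct _)).
  intros r (x & y & Hxy & ->); simpl.
  apply Rle_trans with (omega (rho x y)); [apply Hf|].
  apply omega_mono; split; [apply rho_pos|exact Hxy].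
Qed.

Lemma modulus_eq f s : 0 <= s -> C_omega X rho omega f ->
  (forall eps, 0 < eps -> exists x y, rho x y <= s /\ omega s - eps < rho (f x) (f y)) ->
  modulus X rho f s = Finite (omega s).
Proof.
intros Hs Hf H; apply is_lub_Rbar_unique; split.
- intros r (x & y & Hxy & ->); simpl.
  apply Rle_trans with (omega (rho x y)); [apply C_omega_iff; exact Hf|].
  apply omega_mono; split; [apply rho_pos|exact Hxy].
- intros b Hb.
  assert (Hw : forall eps, 0 < eps -> Rbar_le (omega s - eps) b).
  { intros eps He; destruct (H eps He) as (x & y & Hxy & Hlt).
    apply Rbar_le_trans with (rho (f x) (f y)); [simpl; lra|].
    apply Hb; exists x, y; auto. }
  destruct b as [b| |]; simpl in *; auto.
  + apply Rnot_lt_le; intros Hlt.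
    pose proof (Hw ((omega s - b) / 2) ltac:(lra)); lra.
  + exact (Hw 1 Rlt_0_1).
Qed.

(** * Construction of nearby maps with large modulus *)

Lemma finite_bound (l : list X) (k : X -> R) :
  exists K, 0 < K /\ forall x, In x l -> k x <= K.
Proof.
induction l as [|a l (K & HK & IH)].
- exists 1; split; [lra|]; intros x [].
- exists (Rmax K (k a)); split.
  + pose proof (Rmax_l K (k a)); lra.
  + intros x [->|Hx]; [apply Rmax_r|].
    apply Rle_trans with K; [auto|apply Rmax_l].
Qed.

(** The contraction factor is at most [1 - e], which reserves [e * omega (rho x y)] for the
    variation of the factor itself. *)
Lemma eventually_constant_approx p (g : X -> X) (l : list X) eps :
  (forall x y, rho (g x) (g y) <= omega (rho x y)) -> 0 < eps ->
  exists (f : X -> X) (r : R), 0 < r /\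
    (forall x y, rho (f x) (f y) <= omega (rho x y)) /\
    (forall x, In x l -> rho p x <= r /\ rho (f x) (g x) < eps) /\
    f p = g p /\ (forall x, r <= rho p x -> f x = g p).
Proof.
intros Hgw Heps; set (q := g p).
destruct (finite_bound l (rho p)) as (r0 & Hr0 & Hl).
destruct (finite_bound l (fun x => rho q (g x))) as (K & HK & HlK).
(* A point [x] of [l] has its value moved by [e * rho q (g x) <= e * K], at most [eps / 2]. *)
set (e := Rmin (1 / 2) (eps / (2 * K))).
assert (He : 0 < e < 1 /\ e * K < eps).
{ assert (He0 : 0 < eps / (2 * K)) by (apply Rdiv_lt_0_compat; lra).
  pose proof (Rmin_l (1 / 2) (eps / (2 * K))) as H1.
  pose proof (Rmin_r (1 / 2) (eps / (2 * K))) as H2.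
  pose proof (Rmin_glb_lt (1 / 2) (eps / (2 * K)) 0 ltac:(lra) He0) as H3.
  fold e in H1, H2, H3.
  apply Rmult_le_compat_r with (r := K) in H2; [|lra].
  replace (eps / (2 * K) * K) with (eps / 2) in H2 by (field; lra).
  lra. }
destruct He as [He HeK].
destruct (log_cutoff e r0 He Hr0) as (lam & r & Hr & Hlam & Hin & Hout & Hslope).
exists (fun x => cc q (g x) (lam (rho p x))), r; repeat split.
- lra.
- assert (Hwlog : forall x y, rho p x <= rho p y ->
    rho (cc q (g x) (lam (rho p x))) (cc q (g y) (lam (rho p y))) <= omega (rho x y)).
  { intros x y Hxy.
    set (a := rho p x) in *; set (b := rho p y) in *; set (d := rho x y).
    assert (Ha : 0 <= a) by apply rho_pos.
    destruct (Hslope a b ltac:(lra)) as [Hmono Hs].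
    pose proof (Hlam a) as Hla; pose proof (Hlam b) as Hlb.
    pose proof (convex_comb_interp q (g x) (g y) (lam a) (lam b)
      ltac:(lra) ltac:(lra)) as HI.
    pose proof (Hgw p x) as Hqx; fold q a in Hqx.
    pose proof (Hgw x y) as Hxyw; fold d in Hxyw.
    assert (Hd : b - a <= d)
      by (pose proof (rho_tri p x y); unfold a, b, d; lra).
    assert (Hd0 : 0 <= d) by apply rho_pos.
    pose proof (omega_nonneg d Hd0); pose proof (omega_nonneg a Ha).
    assert (HI' : rho (cc q (g x) (lam a)) (cc q (g y) (lam b)) <=
      (lam a - lam b) * omega a + lam b * omega d) by nra.
    eapply Rle_trans; [exact HI'|].
    (* If [a <= d], then [omega a <= omega d] and the bound is at most [lam a * omega d]. If
       [0 < d < a], the slope bound [e / a] and [omega a <= (a / d) * omega d] make the first term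
       at most [e * omega d]. *)
    destruct (Rle_or_lt a d) as [Had|Had].
    - pose proof (omega_mono a d ltac:(lra)); nra.
    - destruct (Req_dec d 0) as [Ed|Ed].
      + assert (x = y) by (apply rho_eq; exact Ed); subst y.
        change b with a; rewrite Rminus_diag, Rmult_0_l, Rplus_0_l.
        rewrite <- (Rmult_1_l (omega d)) at 2; apply Rmult_le_compat_r; lra.
      + pose proof (admissible_omega_ratio omega a d Ho ltac:(lra)) as Hrat.
        assert (HD : (lam a - lam b) * omega a <= e * omega d).
        { apply Rmult_le_reg_l with d; [lra|].
          apply Rle_trans with ((lam a - lam b) * (a * omega d)); [nra|].
          rewrite <- Rmult_assoc.
          apply Rle_trans with (e * (b - a) * omega d).
          { apply Rmult_le_compat_r; lra. }
          replace (d * (e * omega d)) with (e * d * omega d) by ring.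
          apply Rmult_le_compat_r; [lra|].
          apply Rmult_le_compat_l; lra. }
        apply Rle_trans with (e * omega d + (1 - e) * omega d); [|lra].
        apply Rplus_le_compat; [exact HD|apply Rmult_le_compat_r; lra]. }
  intros x y; destruct (Rle_or_lt (rho p x) (rho p y)) as [H|H].
  + apply Hwlog; exact H.
  + rewrite (rho_sym x y), rho_sym; apply Hwlog; lra.
- pose proof (Hl x H); lra.
- rewrite Hin by auto.
  rewrite convex_comb_dist_r by lra.
  pose proof (HlK x H); simpl in *.
  pose proof (rho_pos q (g x)); nra.
- fold q; symmetry; apply rho_eq.
  rewrite convex_comb_dist_l by (pose proof (Hlam (rho p p)); lra).
  change (g p) with q; rewrite (rho_refl q); ring.
- intros x Hx; rewrite Hout by exact Hx; apply convex_comb_0.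
Qed.

(* Near [z] the bump runs along the geodesic from [u] to [w] fast enough to realise
   [c * omega s]; away from [z] it returns slowly to [q]. *)
Lemma localized_bump q u w s T c :
  0 < s <= T -> 0 < c < 1 -> c * omega s <= rho u w ->
  rho q u <= omega T -> rho q w <= omega T ->
  exists r, s <= r /\ forall z, exists f : X -> X,
    (forall x y, rho (f x) (f y) <= omega (rho x y)) /\
    (forall a x, rho a q <= omega T -> rho a u <= omega T -> rho a w <= omega T ->
       rho a (f x) <= omega T) /\
    (forall x, r <= rho z x -> f x = q) /\
    (forall y, rho z y = s -> rho (f z) (f y) = c * omega s).
Proof.
intros Hs Hc Huw Hqu Hqw.
(* [k] is the slope of the cut-off [lam], which vanishes at [s + / k]; [k * T = 1 - c] is the share
   of the modulus left over by the factor [c]. *)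
set (k := (1 - c) / T).
assert (HkT : k * T = 1 - c) by (unfold k; field; lra).
assert (Hk : 0 < k) by (apply Rdiv_lt_0_compat; lra).
exists (s + / k); split; [pose proof (Rinv_0_lt_compat k Hk); lra|intros z].
assert (Hws : 0 < omega s) by (apply admissible_omega_pos; [exact Ho|lra]).
assert (HwT : omega s <= omega T) by (apply omega_mono; lra).
assert (Huw0 : 0 < rho u w) by nra.
(* Normalised so that the distance from [u] to the bump falls from [c * omega s] at [z] to 0 at
   distance [s]. Subadditivity of [omega] then gives modulus at most [c * omega]. *)
set (psi := fun x => c * Rmax 0 (omega s - omega (rho z x)) / rho u w).
assert (Hpsi : forall x, 0 <= psi x <= 1).
{ intros x; pose proof (omega_nonneg (rho z x) (rho_pos z x)).
  assert (Hb : 0 <= Rmax 0 (omega s - omega (rho z x)) <= omega s)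
    by (split; [apply Rmax_l|apply Rmax_lub; lra]).
  unfold psi; split.
  - apply Rdiv_le_0_compat; [nra|lra].
  - apply Rmult_le_reg_r with (rho u w); [lra|].
    unfold Rdiv; rewrite Rmult_assoc, Rinv_l by lra; nra. }
assert (Homega : forall x y, omega (rho z y) <= omega (rho z x) + omega (rho x y)).
{ intros x y; apply Rle_trans with (omega (rho z x + rho x y)).
  - apply omega_mono; split; [apply rho_pos|apply rho_tri].
  - apply admissible_omega_subadditive; auto using rho_pos. }
set (h := fun x => cc u w (psi x)).
assert (Hh' : forall x y, rho (h x) (h y) <= c * omega (rho x y)).
{ intros x y; unfold h; rewrite convex_comb_dist by apply Hpsi.
  rewrite <- (Rabs_pos_eq (rho u w)) by lra; rewrite <- Rabs_mult.
  replace ((psi x - psi y) * rho u w) with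
    (c * (Rmax 0 (omega s - omega (rho z x)) - Rmax 0 (omega s - omega (rho z y))))
    by (unfold psi; field; lra).
  rewrite Rabs_mult, (Rabs_pos_eq c) by lra.
  apply Rmult_le_compat_l; [lra|].
  pose proof (Homega x y); pose proof (Homega y x).
  rewrite (rho_sym y x) in *.
  apply Rabs_le; unfold Rmax; repeat destruct Rle_dec; lra. }
assert (Hhball : forall a x, rho a u <= omega T -> rho a w <= omega T ->
  rho a (h x) <= omega T).
{ intros a x Hu Hw; apply convex_comb_ball; auto. }
set (lam := fun r => Rmax 0 (Rmin 1 (1 - k * (r - s)))).
assert (Hlam : forall r, 0 <= lam r <= 1).
{ intros r; split; [apply Rmax_l|].
  apply Rmax_lub; [lra|apply Rmin_l]. }
assert (Hlams : forall r, r <= s -> lam r = 1).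
{ intros r Hr; unfold lam; rewrite Rmin_left by nra; apply Rmax_right; lra. }
assert (Hlip : forall a b, a <= b -> lam b <= lam a <= lam b + k * (b - a)).
{ intros a b Hab; assert (0 <= k * (b - a)) by nra.
  unfold lam, Rmax, Rmin; repeat destruct Rle_dec; nra. }
exists (fun x => cc q (h x) (lam (rho z x))); repeat split.
- assert (Hwlog : forall x y, rho z x <= rho z y ->
    rho (cc q (h x) (lam (rho z x))) (cc q (h y) (lam (rho z y))) <= omega (rho x y)).
  { intros x y Hxy.
    set (a := rho z x) in *; set (b := rho z y) in *; set (d := rho x y).
    pose proof (Hlip a b Hxy) as Hab.
    pose proof (Hlam a) as Hla; pose proof (Hlam b) as Hlb.
    pose proof (convex_comb_interp q (h x) (h y) (lam a) (lam b)
      ltac:(lra) ltac:(lra)) as HI.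
    pose proof (Hhball q x Hqu Hqw) as Hqx.
    pose proof (Hh' x y) as Hxyw; fold d in Hxyw.
    assert (Hd : b - a <= d)
      by (pose proof (rho_tri z x y); unfold a, b, d; lra).
    assert (Hd0 : 0 <= d) by apply rho_pos.
    pose proof (omega_nonneg d Hd0).
    assert (HI' : rho (cc q (h x) (lam a)) (cc q (h y) (lam b)) <=
      (lam a - lam b) * omega T + lam b * (c * omega d)) by nra.
    eapply Rle_trans; [exact HI'|].
    (* For [T <= d] monotonicity suffices. For [d < T] the cut-off contributes at most [k * d *
       omega T <= k * T * omega d = (1 - c) * omega d]. *)
    destruct (Rle_or_lt T d) as [Had|Had].
    - apply Rle_trans with ((lam a - lam b) * omega d + lam b * omega d); [|nra].
      apply Rplus_le_compat; apply Rmult_le_compat_l; [lra| |lra|nra].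
      apply omega_mono; lra.
    - pose proof (admissible_omega_ratio omega T d Ho ltac:(lra)) as Hrat.
      assert (HD : (lam a - lam b) * omega T <= (1 - c) * omega d).
      { apply Rle_trans with (k * d * omega T).
        { apply Rmult_le_compat_r; [lra|].
          apply Rle_trans with (k * (b - a)); [lra|apply Rmult_le_compat_l; lra]. }
        rewrite <- HkT, !Rmult_assoc; apply Rmult_le_compat_l; lra. }
      assert (lam b * (c * omega d) <= 1 * (c * omega d)); [|lra].
      apply Rmult_le_compat_r; nra. }
  intros x y; destruct (Rle_or_lt (rho z x) (rho z y)) as [H|H].
  + apply Hwlog; exact H.
  + rewrite (rho_sym x y), rho_sym; apply Hwlog; lra.
- intros a x Hq Hu Hw; apply convex_comb_ball; auto.
- intros x Hx.
  assert (E : lam (rho z x) = 0).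
  { assert (1 <= k * (rho z x - s)).
    { rewrite <- (Rinv_r k) by lra; apply Rmult_le_compat_l; lra. }
    unfold lam; apply Rmax_left; pose proof (Rmin_r 1 (1 - k * (rho z x - s))); lra. }
  rewrite E; apply convex_comb_0.
- intros y Hy; rewrite !Hlams by (rewrite ?rho_refl; lra).
  assert (E1 : forall v, cc q v 1 = v)
    by (intros v; unfold convex_comb; rewrite Rmult_1_l; apply Hg).
  rewrite !E1; unfold h; rewrite convex_comb_dist by apply Hpsi.
  unfold psi; rewrite Hy, rho_refl.
  destruct Ho as (_ & _ & _ & _ & _ & H0); rewrite H0.
  rewrite (Rmax_left 0 (omega s - omega s)), (Rmax_right 0) by lra.
  rewrite Rabs_pos_eq.
  + field; lra.
  + replace (_ - _) with (c * omega s / rho u w) by (field; lra).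
    apply Rdiv_le_0_compat; nra.
Qed.

(** For [x] in the ball around [p] and [y] outside it, either [y] is at least [r2] from [z], where
    [f2 y = q = f1 y], or [rho x y >= T] and the bound [omega T] is enough. *)
Lemma far_gluing p z r1 r2 T q (f1 f2 : X -> X) :
  0 <= T -> r1 + r2 + T <= rho p z ->
  (forall x y, rho (f1 x) (f1 y) <= omega (rho x y)) ->
  (forall x y, rho (f2 x) (f2 y) <= omega (rho x y)) ->
  (forall x, r1 <= rho p x -> f1 x = q) ->
  (forall x, r2 <= rho z x -> f2 x = q) ->
  (forall x y, rho (f1 x) (f2 y) <= omega T) ->
  exists f, (forall x y, rho (f x) (f y) <= omega (rho x y)) /\
    (forall x, rho p x <= r1 -> f x = f1 x) /\
    (forall x, r1 < rho p x -> f x = f2 x).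
Proof.
intros HT Hz H1 H2 Hq1 Hq2 H12.
set (f := fun x => if Rle_dec (rho p x) r1 then f1 x else f2 x).
exists f; repeat split.
- assert (Hmix : forall x y, rho p x <= r1 -> r1 < rho p y ->
    rho (f1 x) (f2 y) <= omega (rho x y)).
  { intros x y Hx Hy; destruct (Rle_or_lt r2 (rho z y)) as [H|H].
    - rewrite Hq2 by exact H; rewrite <- (Hq1 y) by lra; apply H1.
    - apply Rle_trans with (omega T); [apply H12|].
      apply omega_mono; split; [exact HT|].
      pose proof (rho_tri p x z); pose proof (rho_tri x y z).
      rewrite (rho_sym y z) in *; lra. }
  intros x y; unfold f.
  destruct (Rle_dec (rho p x) r1), (Rle_dec (rho p y) r1); auto.
  + apply Hmix; lra.
  + rewrite rho_sym, (rho_sym x y); apply Hmix; lra.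
- intros x Hx; unfold f; destruct Rle_dec; [reflexivity|lra].
- intros x Hx; unfold f; destruct Rle_dec; [lra|reflexivity].
Qed.

Lemma large_modulus_dense (Hu : unbounded_space X rho) (g : X -> X) (l : list X) eps s eta :
  C_omega X rho omega g -> 0 < eps -> 0 <= s -> 0 < eta ->
  exists f x y, pw_nbhd X rho (C_omega X rho omega) g l eps f /\
    rho x y <= s /\ omega s - eta < rho (f x) (f y).
Proof.
intros Hgw Heps Hs Heta.
destruct (Hu 0) as (p & _ & _).
(* For [s = 0] the map [g] itself works, because [omega 0 - eta < 0]. *)
destruct (Req_dec s 0) as [->|Hs0].
{ exists g, p, p; repeat split; auto.
  - intros x _; rewrite rho_refl; lra.
  - rewrite rho_refl; lra.
  - destruct Ho as (_ & _ & _ & _ & _ & ->); rewrite rho_refl; lra. }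
pose proof (proj1 (C_omega_iff g) Hgw) as Hgw'.
destruct (eventually_constant_approx p g l eps Hgw' Heps)
  as (f1 & r1 & Hr1 & Hf1 & Hl & Hp & Hout1).
set (q := g p) in *.
(* All values of [f1] are taken on the ball of radius [r1] around [p], so [2 * r1 <= T] bounds the
   diameter of its range by [omega T]. *)
set (T := Rmax (2 * r1) s).
assert (HT : 2 * r1 <= T /\ s <= T) by (split; [apply Rmax_l|apply Rmax_r]).
set (c := 1 - Rmin (1 / 2) (eta / (2 * omega s))).
assert (Hws : 0 < omega s) by (apply admissible_omega_pos; [exact Ho|lra]).
assert (HwT : omega s <= omega T) by (apply omega_mono; lra).
assert (Hc : 0 < c < 1 /\ omega s - eta < c * omega s).
{ assert (He0 : 0 < eta / (2 * omega s)) by (apply Rdiv_lt_0_compat; lra).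
  pose proof (Rmin_l (1 / 2) (eta / (2 * omega s))) as L1.
  pose proof (Rmin_r (1 / 2) (eta / (2 * omega s))) as L2.
  pose proof (Rmin_glb_lt (1 / 2) (eta / (2 * omega s)) 0 ltac:(lra) He0).
  unfold c.
  apply Rmult_le_compat_r with (r := omega s) in L2; [|lra].
  replace (eta / (2 * omega s) * omega s) with (eta / 2) in L2 by (field; lra).
  lra. }
destruct Hc as [Hc Hcs].
set (P := fun a => exists x, a = f1 x).
assert (HP : forall a b, P a -> P b -> rho a b <= omega T).
{ assert (Hrep : forall x, exists x', rho p x' <= r1 /\ f1 x = f1 x').
  { intros x; destruct (Rle_or_lt (rho p x) r1) as [H|H]; [exists x; auto|].
    exists p; rewrite rho_refl; split; [lra|].
    rewrite Hp; apply Hout1; lra. }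
  intros a b [x ->] [y ->].
  destruct (Hrep x) as (x' & Hx & ->), (Hrep y) as (y' & Hy & ->).
  apply Rle_trans with (omega (rho x' y')); [apply Hf1|].
  apply omega_mono; split; [apply rho_pos|].
  pose proof (rho_tri x' p y'); rewrite (rho_sym x' p) in *; lra. }
(* This tolerance gives [rho u w > omega T - (1 - c) * omega s >= c * omega s], enough room for the
   bump. *)
destruct (extremal_point Hu P q (omega T) ((1 - c) * omega s))
  as (u & w & Pu & Hw & Huw); [exists p; auto|exact HP|nra|].
assert (Pq : P q) by (exists p; auto).
destruct (localized_bump q u w s T c) as (r2 & Hr2 & Hbump); auto; [lra|nra|].
destruct (unbounded_far Hu p (r1 + r2 + T)) as [z Hz].
destruct (Hbump z) as (f2 & Hf2 & Hball & Hout2 & Hz2).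
destruct (far_gluing p z r1 r2 T q f1 f2) as (f & Hf & Hfin & Hfout); auto; [lra..| |].
{ intros x y; apply Hball; [apply HP|apply HP|apply Hw]; auto; exists x; auto. }
(* As [s <= r2], this point stays outside the ball of radius [r1] around [p], so the glued map
   equals [f2] at both [z] and [y]. *)
set (y := geo z p s).
assert (Hzy : rho z y = s).
{ rewrite (rho_sym p z) in Hz; destruct Hg as (D & D0 & _).
  unfold y; rewrite <- (D0 z p) at 1; rewrite D by lra.
  rewrite Rminus_0_l, Rabs_Ropp, Rabs_pos_eq; lra. }
exists f, z, y; repeat split.
- apply C_omega_iff; exact Hf.
- intros x Hx; destruct (Hl x Hx); rewrite Hfin; auto.
- lra.
- rewrite !Hfout, Hz2; auto; try lra.
  pose proof (rho_tri p y z); rewrite (rho_sym y z) in *; lra.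
Qed.

(** * Nowhere density and the countable cover *)

Definition small_modulus (s eta : R) (f : X -> X) : Prop :=
  C_omega X rho omega f /\ forall x y, rho x y <= s -> rho (f x) (f y) <= omega s - eta.

(** A pair [x], [y] on which [f] exceeds the bound by [gap] excludes every map within [gap / 2] of
    [f] at these two points; closedness and empty interior are used together. *)
Lemma small_modulus_nowhere_dense (Hu : unbounded_space X rho) s eta :
  0 <= s -> 0 < eta -> pw_nowhere_dense X rho (C_omega X rho omega) (small_modulus s eta).
Proof.
intros Hs Heta U [HUS HU] Hcl g Ug.
destruct (HU g Ug) as (l & eps & Heps & Hnb).
destruct (large_modulus_dense Hu g l eps s eta (HUS g Ug) Heps Hs Heta)
  as (f & x & y & Hf & Hxy & Hlt).
set (gap := rho (f x) (f y) - (omega s - eta)).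
destruct (Hcl f (Hnb f Hf)) as [_ Hc].
destruct (Hc (x :: y :: nil) (gap / 2)) as (f' & [_ Hn] & [_ Hsmall]); [unfold gap; lra|].
pose proof (Hsmall x y Hxy).
pose proof (Hn x ltac:(simpl; auto)); pose proof (Hn y ltac:(simpl; auto)).
pose proof (rho_tri (f x) (f' x) (f y)); pose proof (rho_tri (f' x) (f' y) (f y)).
rewrite (rho_sym (f x) (f' x)) in *.
unfold gap in *; lra.
Qed.

(** One index [j] gives both the denominator and the defect [/ INR (S j)], so two natural numbers
    index the whole cover. *)
Lemma rational_below s delta : 0 <= s -> 0 < delta ->
  exists i j, / INR (S j) < delta /\ 0 <= INR i / INR (S j) <= s /\
    s - INR i / INR (S j) < delta.
Proof.
intros Hs Hd.
destruct (archimed_cor1 delta Hd) as ([|j] & Hj & Hj0); [lia|].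
assert (HS : 0 < INR (S j)) by (apply lt_0_INR; lia).
destruct (nfloor_ex (s * INR (S j)) ltac:(nra)) as (i & Hi1 & Hi2).
exists i, j; repeat split.
- exact Hj.
- apply Rdiv_le_0_compat; [apply pos_INR|exact HS].
- apply Rmult_le_reg_r with (INR (S j)); [exact HS|].
  unfold Rdiv; rewrite Rmult_assoc, Rinv_l by lra; lra.
- apply Rlt_trans with (2 := Hj).
  apply Rmult_lt_reg_r with (INR (S j)); [exact HS|].
  rewrite Rinv_l, Rmult_minus_distr_r by lra.
  unfold Rdiv; rewrite Rmult_assoc, Rinv_l by lra; lra.
Qed.

Lemma modulus_eq_of_rational f : C_omega X rho omega f ->
  (forall i j, ~ small_modulus (INR i / INR (S j)) (/ INR (S j)) f) ->
  forall s, 0 <= s -> modulus X rho f s = Finite (omega s).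
Proof.
intros Hf Hns s Hs; apply modulus_eq; auto.
intros eps Heps.
destruct Ho as (_ & Hcont & _).
destruct (Hcont s Hs (eps / 2) ltac:(lra)) as (delta & Hdelta & Hcd).
(* Half of [eps] pays for replacing [s] by a rational below it, the other half for the defect.
   Approximation from below keeps [rho x y <= s]. *)
destruct (rational_below s (Rmin delta (eps / 2)) Hs) as (i & j & Hj & Hi & Hclose).
{ apply Rmin_glb_lt; lra. }
pose proof (Rmin_l delta (eps / 2)); pose proof (Rmin_r delta (eps / 2)).
assert (Hom : omega s - eps / 2 < omega (INR i / INR (S j))).
{ apply Rabs_lt_between' with (1 := Hcd _ (proj1 Hi)
    ltac:(rewrite Rabs_minus_sym, Rabs_pos_eq; lra)). }
apply NNPP; intros Hno; apply (Hns i j); split; [exact Hf|].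
intros x y Hxy; apply Rnot_lt_le; intros Hlt; apply Hno.
exists x, y; lra.
Qed.

End Hyperbolic.

Theorem theorem5p2 (X : Type) (rho : X -> X -> R) (geo : X -> X -> R -> X)
  (omega : R -> R) :
  is_metric X rho ->
  coherent_geodesics X rho geo ->
  hyperbolic X rho geo ->
  complete_space X rho ->
  separable_space X rho ->
  unbounded_space X rho ->
  admissible_omega omega ->
  exists M : (X -> X) -> Prop,
    (forall f, M f -> C_omega X rho omega f) /\
    pw_meagre X rho (C_omega X rho omega) M /\
    forall f, C_omega X rho omega f -> ~ M f ->
      forall s, 0 <= s -> modulus X rho f s = Finite (omega s).
Proof.
intros Hm Hg Hh _ _ Hu Ho.
set (A := fun n : nat => let (i, j) := Cantor.of_nat n in
  small_modulus X rho omega (INR i / INR (S j)) (/ INR (S j))).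
exists (fun f => exists n, A n f); split; [|split].
- intros f [n Hn]; unfold A in Hn; destruct (Cantor.of_nat n); apply Hn.
- exists A; split; [|auto].
  intros n; unfold A; destruct (Cantor.of_nat n) as [i j].
  assert (HS : 0 < INR (S j)) by (apply lt_0_INR; lia).
  apply small_modulus_nowhere_dense with geo; auto.
  + apply Rdiv_le_0_compat; [apply pos_INR|exact HS].
  + apply Rinv_0_lt_compat; exact HS.
- intros f Hf HM; apply modulus_eq_of_rational; auto.
  intros i j Hij; apply HM; exists (Cantor.to_nat (i, j)).
  unfold A; rewrite Cantor.cancel_of_to; exact Hij.
Qed.
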